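(* Let $m \geq 4$ be an integer and let $s_{ij}$ be positive real numbers, one for each pair $(i,j)$ of integers with $2 \leq i < j \leq m$ and $(i,j) \neq (2,m)$. Let $q_{ij}(x)$ denote the $2\times 2$ minor formed by columns $i$ and $j$ of the $2 \times m$ matrix $$\begin{bmatrix} 0 & 1 & 1 & 1 & \cdots & 1 & 1 & 1 \\ -1 & 0 & x_1 & x_2 & \cdots & x_{m-4} & x_{m-3} & 1 \end{bmatrix},$$ and let $L(x) = \sum_{(i,j)} s_{ij} \log(q_{ij}(x))$, the sum being over all pairs $(i,j)$ of integers with $2 \leq i < j \leq m$ and $(i,j) \neq (2,m)$. Then the system of likelihood equations $$\frac{\partial L}{\partial x_1} = \frac{\partial L}{\partial x_2} = \cdots = \frac{\partial L}{\partial x_{m-3}} = 0$$ has precisely $(m-3)!$ complex solutions $x = (x_1,\ldots,x_{m-3})$. All of these solutions are real, and there is one solution for each of the orderings of the $m-3$ coordinates; that is, for each permutation $\pi$ of $\{1,\ldots,m-3\}$ there is exactly one solution with $x_{\pi_1} < x_{\pi_2} < \cdots < x_{\pi_{m-3}}$.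
   Context: Explicitly, $q_{2j} = x_{j-2}$ for $3 \le j \le m-1$; $q_{ij} = x_{j-2} - x_{i-2}$ for $3 \le i < j \le m-1$; and $q_{im} = 1 - x_{i-2}$ for $3 \le i \le m-1$. The partial derivatives of $L$ are the rational functions $$\frac{\partial L}{\partial x_k} = \sum_{(i,j)} \frac{s_{ij}}{q_{ij}(x)} \frac{\partial q_{ij}}{\partial x_k}, \qquad k = 1, \ldots, m-3.$$ A complex solution of the likelihood equations is a point $x \in \mathbb{C}^{m-3}$ at which all $q_{ij}(x)$ (for the pairs $(i,j)$ in the sum) are nonzero and at which all of these rational functions vanish. The set of points of $\mathbb{C}^{m-3}$ where all $q_{ij}$ are nonzero is the moduli space $\mathcal{M}_{0,m}$ of $m$ distinct marked points on $\mathbb{P}^1$, i.e. the complement of the hyperplanes $\{x_i = 0\}$, $\{x_i = 1\}$ and $\{x_i = x_j\}$ for $i \ne j$. *)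

(* Defs.v *)
From mathcomp Require Import all_boot all_order all_algebra.
From mathcomp Require Import complex reals.
From mathcomp Require Import mpoly.
Set Implicit Arguments.
Unset Strict Implicit.
Unset Printing Implicit Defensive.
Import GRing.Theory Num.Theory.
Local Open Scope ring_scope.
Local Open Scope complex_scope.

(* Columns, pairs and coordinates are numbered from 0: the (j+1)-st column of
   the 2 x m matrix has index j, and the coordinate x_(k+1) is 'X_k. *)

(* For j >= 2 the bottom entry is 'X_(j - 2) whenever j - 2 < m - 3, and the
   default 1 is reached only in the last column, j = m - 1. *)
Definition config_mx (m : nat) (A : comNzRingType) :
    'M[{mpoly A[m - 3]}]_(2, m) :=
  \matrix_(i < 2, j < m)
    if i == 0 then (if j == 0%N :> nat then 0 else 1)
    else if j == 0%N :> nat then -1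
    else if j == 1%N :> nat then 0
    else if insub (j - 2)%N is Some k then 'X_k else 1.

Definition q (m : nat) (A : comNzRingType) (i j : 'I_m) : {mpoly A[m - 3]} :=
  \det (colsub (fun b : 'I_2 => if b == 0 then i else j) (config_mx m A)).

(* The pairs 2 <= i < j <= m other than (2, m), shifted by one. *)
Definition index_pair (m : nat) (i j : 'I_m) : bool :=
  [&& (0 < i)%N, (i < j)%N & (i : nat, j : nat) != (1%N, m.-1)].

(* The partial derivative of L = sum s_ij log q_ij in the k-th coordinate,
   evaluated at x; no branch of the logarithm is involved. *)
Definition dL (R : realType) (m : nat) (s : 'I_m -> 'I_m -> R) (k : 'I_(m - 3))
    (x : 'rV[R[i]]_(m - 3)) : R[i] :=
  \sum_(i < m) \sum_(j < m | index_pair i j)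
    (s i j)%:C / (q R[i] i j).@[x 0] * (mderiv k (q R[i] i j)).@[x 0].

Definition likelihood_solution (R : realType) (m : nat)
    (s : 'I_m -> 'I_m -> R) (x : 'rV[R[i]]_(m - 3)) : Prop :=
  (forall i j : 'I_m, index_pair i j -> (q R[i] i j).@[x 0] != 0) /\
  (forall k : 'I_(m - 3), dL s k x = 0).

(* Main.v *)
Require Import Defs.
From mathcomp Require Import all_boot all_order all_algebra all_fingroup.
From mathcomp Require Import -(notations) mpoly.
From mathcomp Require Import all_classical reals complex.
From mathcomp Require Import topology normedtype derive realfun sequences exp.
From mathcomp Require Import zify ring.
Set Implicit Arguments.
Unset Strict Implicit.
Unset Printing Implicit Defensive.
Import Order.TTheory GRing.Theory Num.Theory.
Import numFieldNormedType.Exports.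
Local Open Scope ring_scope.
Local Open Scope classical_set_scope.
Local Open Scope card_scope.

(** Write z_2 = 0 and z_m = 1 for the two fixed finite marked points, and z_3,
..., z_(m-1) for the coordinates of x.  Then q_ij is z_j - z_i, so the
likelihood equations ask for the equilibria of m - 3 movable point charges on
the plane, repelling each other and repelled by the fixed charges at 0 and 1
with force s_ij / distance.

All equilibria lie on the segment from 0 to 1.  As in the Gauss-Lucas theorem,
take a linear form on the plane and a movable point where it is largest; if the
value there exceeded the values at 0 and at 1, every force on that point would
push it weakly outwards, and the force from 0 strictly so, which contradicts
equilibrium ([critical_halfplane]).  The four forms Re, -Re, Im and -Im leave
only the real interval [0, 1] ([critical_is_real]); since no q_ij vanishes, the
points are pairwise distinct and different from 0 and 1.

It remains to find exactly one equilibrium for each ordering of the points in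
]0, 1[.  Each ordering is an open convex bounded region, cut out by the affine
forms q_ij with signs chosen so that they are positive.  On it L, up to an
additive constant, is the sum of s_ij times the logarithm of the form for
(i, j).
- Existence ([exists_critical_point]): exp L, a product of positive powers of
  the forms, extends continuously by zero to the whole cube, so it attains a
  maximum; the maximum is positive, hence it lies inside the region and is a
  critical point of L.
- Uniqueness ([critical_point_unique]): u |-> 1/u is decreasing, so the gradient
  of L is strictly monotone; this is the strict concavity of L.

Every point with distinct coordinates is sorted by exactly one permutation, so
the solutions are in bijection with the (m-3)! permutations. *)

(** * Critical points of weighted sums of logarithms of affine forms *)

Definition affine_form (R : comNzRingType) n (a : R) (b : 'I_n -> R)
  (x : 'rV[R]_n) : R := a + \sum_k b k * x 0 k.

(** The truncation at zero makes the power continuous on the whole line, and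
zero exactly outside the region where the base is positive. *)
Definition pos_pow (R : realType) (c u : R) : R := powR (Num.max 0 u) c.

Lemma pos_pow_ge0 (R : realType) (c u : R) : 0 <= pos_pow c u.
Proof. exact: powR_ge0. Qed.

Lemma pos_pow_gt0 (R : realType) (c u : R) : 0 < c ->
  (0 < pos_pow c u) = (0 < u).
Proof.
move=> c0; rewrite /pos_pow; case: (ltP 0 u) => u0; first exact: powR_gt0.
by rewrite powR0 ?gt_eqF // ltxx.
Qed.

Lemma pos_powE (R : realType) (c u : R) :
  0 < u -> pos_pow c u = expR (c * ln u).
Proof. by move=> u0; rewrite /pos_pow max_r ?(ltW u0) // /powR gt_eqF. Qed.

Lemma continuous_pos_pow (R : realType) (c : R) : 0 < c ->
  continuous (pos_pow c).
Proof.
move=> c0 u; have [u0|u0] := ltP 0 u.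
  apply: (@cvg_trans _ ((fun v => expR (c * ln v)) @ u)).
    apply: near_eq_cvg; near=> v; rewrite /= pos_powE //.
    by near: v; exact: lt_nbhsr.
  rewrite /continuous_at pos_powE //.
  apply: (@continuous_comp _ _ _ (fun v => c * ln v) expR);
    last exact: continuous_expR.
  by apply: cvgM; [exact: cvg_cst|exact: continuous_ln].
have pu0 : pos_pow c u = 0 by rewrite /pos_pow max_l // powR0 ?gt_eqF.
rewrite /continuous_at pu0.
apply/cvgrPdist_lt => e e0.
(* For positive v, v ^ c < e holds exactly when v is below e ^ (1/c), a
   positive bound. *)
have ule : u < powR e c^-1 by apply: (le_lt_trans u0); exact: powR_gt0.
near=> v.
rewrite sub0r normrN ger0_norm ?pos_pow_ge0 //.
have le : v < powR e c^-1 by near: v; exact: lt_nbhsl.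
apply: (@lt_le_trans _ _ (pos_pow c (powR e c^-1))).
  have [v0|v0] := ltP 0 v; last first.
    by rewrite {1}/pos_pow max_l // powR0 ?gt_eqF // pos_pow_gt0 // powR_gt0.
  rewrite /pos_pow !max_r ?(ltW v0) ?powR_ge0 // gt0_ltr_powR //.
    by rewrite nnegrE ltW.
  by rewrite nnegrE powR_ge0.
by rewrite /pos_pow max_r ?powR_ge0 // -powRrM mulVf ?gt_eqF // powRr1 // ltW.
Unshelve. all: by end_near. Qed.

Lemma continuous_affine_form (R : realType) n (a : R) (b : 'I_n -> R) :
  continuous (affine_form a b).
Proof.
suff sumc : continuous (fun x : 'rV[R]_n => \sum_k b k * x 0 k).
  by move=> x; apply: continuousD; [exact: cst_continuous|exact: sumc].
apply: (@continuous_big _ _ _ _ _ _ _ _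
  (fun k (x : 'rV[R]_n) => b k * x 0 k)) => [|k _ z].
  exact: add_continuous.
by apply: continuousM; [exact: cst_continuous|exact: coord_continuous].
Qed.

Lemma affine_formB (R : comNzRingType) n (a : R) (b : 'I_n -> R) x y :
  affine_form a b x - affine_form a b y = \sum_k b k * (x 0 k - y 0 k).
Proof.
rewrite /affine_form opprD addrACA subrr add0r -sumrB.
by apply: eq_bigr => k _; rewrite mulrBr.
Qed.

Lemma affine_form_line (R : comNzRingType) n (a : R) (b : 'I_n -> R) x k h :
  affine_form a b (x + h *: delta_mx 0 k) = affine_form a b x + h * b k.
Proof.
rewrite /affine_form -addrA; congr (_ + _).
rewrite [in RHS](bigD1 k) //= [in LHS](bigD1 k) //= !mxE !eqxx mulr1 mulrDr.
rewrite -!addrA; congr (_ + _).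
rewrite mulrC addrC; congr (_ + _).
by apply: eq_bigr => l lk; rewrite !mxE (negPf lk) andbF mulr0 addr0.
Qed.

(** The logarithms are unbounded, so the compactness argument is applied to the
product of the truncated powers: it is continuous on the cube [lo, hi]^n, zero
outside the region where all forms are positive and the exponential of the
weighted sum of logarithms inside, and positive at x0. *)
Lemma exists_max_product (R : realType) n (T : finType) (P : pred T)
    (c : T -> R) (l : T -> 'rV[R]_n -> R) (lo hi : R) (x0 : 'rV[R]_n) :
  (forall t, P t -> 0 < c t) ->
  (forall t, P t -> continuous (l t)) ->
  (forall x, (forall t, P t -> 0 < l t x) -> forall k, lo <= x 0 k <= hi) ->
  (forall t, P t -> 0 < l t x0) ->
  exists2 x, (forall t, P t -> 0 < l t x) &
    forall y, (forall t, P t -> 0 < l t y) ->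
      \sum_(t | P t) c t * ln (l t y) <= \sum_(t | P t) c t * ln (l t x).
Proof.
move=> c0 lc bnd lx0.
pose F x := \prod_(t | P t) pos_pow (c t) (l t x).
have Fgt0 x : (forall t, P t -> 0 < l t x) -> 0 < F x.
  by move=> lx; apply: prodr_gt0 => t Pt; rewrite pos_pow_gt0 ?lx ?c0.
have gt0F x : 0 < F x -> forall t, P t -> 0 < l t x.
  move=> Fx t Pt; rewrite -(pos_pow_gt0 _ (c0 t Pt)) lt_def pos_pow_ge0 andbT.
  apply: contraTneq Fx => z; rewrite /F (bigD1 t) //= z mul0r ltxx //.
have FE x : (forall t, P t -> 0 < l t x) ->
    F x = expR (\sum_(t | P t) c t * ln (l t x)).
  by move=> lx; rewrite expR_sum; apply: eq_bigr => t Pt; rewrite pos_powE ?lx.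
pose K := [set x : 'rV[R]_n | forall k, `[lo, hi]%classic (x ord0 k)].
have Kin x : (forall t, P t -> 0 < l t x) -> x \in K.
  by move=> lx; rewrite inE => k /=; rewrite in_itv /= bnd.
have [] := @EVT_max_rV R n F K.
- by exists x0; have := Kin _ lx0; rewrite inE.
- apply: (@rV_compact _ _ (fun=> `[lo, hi]%classic)) => k.
  exact: segment_compact.
- apply: continuous_subspaceT; apply: continuous_big.
    exact: mul_continuous.
  move=> t Pt z; apply: continuous_comp; first exact: lc.
  exact/continuous_pos_pow/c0.
move=> x _ xmax.
have lx := gt0F _ (lt_le_trans (Fgt0 _ lx0) (xmax _ (Kin _ lx0))).
by exists x => // y ly; rewrite -ler_expR -!FE // xmax ?Kin.
Qed.

Lemma is_derive_line (R : realType) (p q h : R) :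
  is_derive h 1 (fun h => p + h * q) q.
Proof.
rewrite (_ : (fun _ => _) = cst p + q \*: id); last first.
  by apply/funext => z; rewrite /= mulrC.
apply: is_derive_eq.
by rewrite add0r /GRing.scale /= mulr1.
Qed.

Lemma is_derive_log_line (R : realType) (c p q h : R) : 0 < p + h * q ->
  is_derive h 1 (fun h => c * ln (p + h * q)) (c / (p + h * q) * q).
Proof.
move=> pos; have dln := is_derive1_ln pos.
have dcomp : is_derive h 1 (@ln R \o (fun h => p + h * q)) _ :=
  @is_derive1_comp R (@ln R) (fun h => p + h * q) h _ _ dln
    (is_derive_line p q h).
have := is_deriveZ c dcomp.
rewrite (_ : c \*: _ = (fun h => c * ln (p + h * q))) //.
by rewrite /GRing.scale /= mulrA.
Qed.

(** A maximizer is an interior point of the region, because finitely many strict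
inequalities between continuous functions define it; so the derivative of the
sum of logarithms vanishes there along each coordinate axis. *)
Lemma exists_critical_point (R : realType) n (T : finType) (P : pred T)
    (c a : T -> R) (b : T -> 'I_n -> R) (lo hi : R) (x0 : 'rV[R]_n) :
  let l t := affine_form (a t) (b t) in
  (forall t, P t -> 0 < c t) ->
  (forall x, (forall t, P t -> 0 < l t x) -> forall k, lo <= x 0 k <= hi) ->
  (forall t, P t -> 0 < l t x0) ->
  exists2 x, (forall t, P t -> 0 < l t x) &
    forall k, \sum_(t | P t) c t / l t x * b t k = 0.
Proof.
move=> l c0 bnd lx0.
have [x lx xmax] := exists_max_product c0
  (fun t _ => @continuous_affine_form R n (a t) (b t)) bnd lx0.
exists x => // k.
pose g h := \sum_(t | P t) c t * ln (l t x + h * b t k).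
have [e e0 near0] : exists2 e : R, 0 < e &
    forall h, h \in `]-e, e[%R -> forall t, P t -> 0 < l t x + h * b t k.
  have : \forall h \near (0 : R), forall t, P t -> 0 < l t x + h * b t k.
    suff H t : \forall h \near (0 : R), P t -> 0 < l t x + h * b t k.
      exact: (filter_forall (nbhs_filter _) H).
    have [Pt|nPt] := boolP (P t); last by near=> h.
    have lc : (fun h => l t x + h * b t k) @ (0 : R) --> l t x + 0 * b t k.
      apply: cvgD; first exact: cvg_cst.
      by apply: cvgM; [exact: cvg_id|exact: cvg_cst].
    rewrite mul0r addr0 in lc.
    have := lc _ (lt_nbhsr (lx t Pt)); rewrite /= => H.
    by near=> h => _; near: h.
  move=> /nbhs_ballP [e e0 He]; exists e => // h; rewrite in_itv /= => hI.
  by apply: He; rewrite /ball /= sub0r normrN ltr_norml.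
have dg h : h \in `]-e, e[%R ->
    is_derive h 1 g (\sum_(t | P t) c t / (l t x + h * b t k) * b t k).
  move=> he.
  rewrite (_ : g = \sum_(t | P t) fun h => c t * ln (l t x + h * b t k));
    last first.
    by apply/funext => z; rewrite /g fct_sumE.
  apply: (big_ind2 (fun (f : R -> R) d => is_derive h 1 f d)).
  - exact: is_derive_cst.
  - by move=> ? ? ? ?; exact: is_deriveD.
  - by move=> t Pt; apply: is_derive_log_line; exact: near0.
have e00 : 0 \in `]-e, e[%R by rewrite in_itv /= oppr_lt0 e0.
have g_max : is_derive (0 : R) (1 : R) g 0.
  apply: (@derive1_at_max R g (- e) e) => // [|h he|h he].
  - by rewrite ge0_cp // ltW.
  - by have := dg h he => -[].
  have lineE z t : l t x + z * b t k = l t (x + z *: delta_mx 0 k).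
    by rewrite /l affine_form_line.
  rewrite /g; under [leRHS]eq_bigr do rewrite mul0r addr0.
  under [leLHS]eq_bigr do rewrite lineE.
  by apply: xmax => t Pt; have := near0 _ he _ Pt; rewrite lineE.
have := dg 0 e00; under eq_bigr do rewrite mul0r addr0.
move=> g_der; have := @derive_val _ _ _ _ _ _ _ g_max.
by rewrite (@derive_val _ _ _ _ _ _ _ g_der).
Unshelve. all: by end_near. Qed.

(** Pairing the difference of the gradients at y and at x with x - y gives the
sum of c_t (l_t x - l_t y) (1 / l_t y - 1 / l_t x), whose terms are nonnegative
and whose value is 0. *)
Lemma critical_point_unique (R : realFieldType) n (T : finType) (P : pred T)
    (c a : T -> R) (b : T -> 'I_n -> R) (x y : 'rV[R]_n) :
  let l t := affine_form (a t) (b t) in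
  (forall t, P t -> 0 < c t) ->
  (forall t, P t -> 0 < l t x) -> (forall t, P t -> 0 < l t y) ->
  (forall k, \sum_(t | P t) c t / l t x * b t k = 0) ->
  (forall k, \sum_(t | P t) c t / l t y * b t k = 0) ->
  forall t, P t -> l t x = l t y.
Proof.
move=> l c0 lx ly critx crity.
pose D t := c t * (l t x - l t y) ^+ 2 / (l t x * l t y).
have D0 t : P t -> 0 <= D t.
  move=> Pt; apply: divr_ge0; apply: mulr_ge0; rewrite ?sqr_ge0 //;
    by rewrite ltW ?c0 ?lx ?ly.
have sumD : \sum_(t | P t) D t = 0.
  apply: (@eq_trans _ _ (\sum_(t | P t) \sum_k
      (x 0 k - y 0 k) * (c t / l t y * b t k - c t / l t x * b t k))).
    apply: eq_bigr => t Pt.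
    have -> : \sum_k (x 0 k - y 0 k) *
          (c t / l t y * b t k - c t / l t x * b t k) =
        (c t / l t y - c t / l t x) * (l t x - l t y).
      rewrite affine_formB mulr_sumr.
      by apply: eq_bigr => k _; ring.
    have := lx t Pt; have := ly t Pt; rewrite /D => /gt_eqF ly0 /gt_eqF lx0.
    by field; rewrite lx0 ly0.
  rewrite exchange_big big1 //= => k _.
  by rewrite -mulr_sumr sumrB critx crity subrr mulr0.
move=> t Pt; have /eqP := psumr_eq0P D0 sumD Pt.
have [[c0t lxt] lyt] := (c0 t Pt, lx t Pt, ly t Pt).
rewrite /D !mulf_eq0 invr_eq0 mulf_eq0 (gt_eqF c0t) (gt_eqF lxt) (gt_eqF lyt).
by rewrite !orbF /= orbb subr_eq0 => /eqP.
Qed.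

(** * The likelihood equations in terms of the marked points *)

(** The value at x of the bottom entry of column j, for columns other than the
point at infinity (column 0). *)
Definition node (m : nat) (A : comNzRingType) (x : 'rV[A]_(m - 3)) (j : 'I_m) :
    A :=
  if j == 1%N :> nat then 0 else if insub (j - 2)%N is Some k then x 0 k else 1.

Lemma node_first (m : nat) (A : comNzRingType) (x : 'rV[A]_(m - 3)) (j : 'I_m) :
  j = 1%N :> nat -> node x j = 0.
Proof. by move=> j1; rewrite /node j1. Qed.

Lemma node_last (m : nat) (A : comNzRingType) (x : 'rV[A]_(m - 3)) (j : 'I_m) :
  (2 < m)%N -> j = m.-1 :> nat -> node x j = 1.
Proof.
move=> m2 jm; rewrite /node ifF; last by lia.
by rewrite insubF //; lia.
Qed.

Lemma node_coord (m : nat) (A : comNzRingType) (x : 'rV[A]_(m - 3)) (j : 'I_m)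
    (k : 'I_(m - 3)) :
  j = (k + 2)%N :> nat -> node x j = x 0 k.
Proof.
move=> jk; rewrite /node jk addn2 /=.
by rewrite subn2 /= valK.
Qed.

Lemma node_cases (m : nat) (j : 'I_m) : (0 < j)%N ->
  [\/ j = 1%N :> nat, j = m.-1 :> nat |
      exists k : 'I_(m - 3), j = (k + 2)%N :> nat].
Proof.
move=> j0; have [j1|j1] := eqVneq (j : nat) 1%N; first by constructor 1.
have [jm|jm] := eqVneq (j : nat) m.-1; first by constructor 2.
have jlt := ltn_ord j.
have kP : (j - 2 < m - 3)%N by lia.
by constructor 3; exists (Ordinal kP) => /=; lia.
Qed.

Lemma node_map (m : nat) (A B : comNzRingType) (f : {rmorphism A -> B})
    (x : 'rV[A]_(m - 3)) (j : 'I_m) : node (map_mx f x) j = f (node x j).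
Proof.
rewrite /node; case: eqP => _; first by rewrite rmorph0.
by case: insub => [k|]; rewrite ?mxE ?rmorph1.
Qed.

Lemma det_mx22 (A : comNzRingType) (M : 'M[A]_2) :
  \det M = M 0 0 * M 1 1 - M 0 1 * M 1 0.
Proof.
rewrite (expand_det_row _ 0) !big_ord_recl big_ord0 addr0 /cofactor !det_mx11.
rewrite !mxE /= expr0 expr1 mul1r mulN1r mulrN.
by congr (_ * M _ _ - M _ _ * M _ _); apply: val_inj.
Qed.

Lemma meval_q (m : nat) (A : comNzRingType) (x : 'rV[A]_(m - 3)) (i j : 'I_m) :
  (0 < i)%N -> (0 < j)%N -> meval (x 0) (q A i j) = node x j - node x i.
Proof.
move=> i0 j0; rewrite /q det_mx22 !mxE /= ![_ == 0%N]gtn_eqF // !mul1r.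
rewrite mevalB /node; congr (_ - _).
all: case: eqP => _; first by rewrite meval0.
all: by case: insub => [k|]; rewrite ?mevalXU ?meval1.
Qed.

(** The k-th partial derivative of [node]. *)
Definition dnode (m : nat) (A : comNzRingType) (k : 'I_(m - 3)) (j : 'I_m) :
    A :=
  (nat_of_ord j == k + 2)%N%:R.

Lemma meval_mderiv_q (m : nat) (A : comNzRingType) (v : 'I_(m - 3) -> A)
    (i j : 'I_m) (k : 'I_(m - 3)) : (0 < i)%N -> (0 < j)%N ->
  meval v (mderiv k (q A i j)) = dnode A k j - dnode A k i.
Proof.
move=> i0 j0; rewrite /q det_mx22 !mxE /= ![_ == 0%N]gtn_eqF // !mul1r.
have one (e : 'I_m) : (0 < e)%N ->
    meval v (mderiv k
      (if e == 1%N :> nat then 0 else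
       if insub (e - 2)%N is Some l then mpoly.mpolyX A (mnm1 l) else 1))
    = dnode A k e.
  rewrite /dnode => e0; case: eqP => [->|/eqP e1].
    by rewrite mderiv0 meval0 addn2.
  have e2 : (e = (e - 2) + 2 :> nat)%N.
    by rewrite subnK //; case: (nat_of_ord e) e0 e1 => [|[]].
  case: insubP => [l _ lE|].
    rewrite mderivX mevalZ mnm1E e2 -lE eqn_add2r.
    have [<-|kl] := eqVneq l k; last first.
      rewrite mul0r; have [/val_inj lk|//] := eqVneq (val l) (val k).
      by rewrite lk eqxx in kl.
    rewrite eqxx mul1r mevalX big1 // => a _.
    by rewrite mnmBE subnn.
  move=> le; rewrite -[X in mderiv k X]/(mpolyC _ 1) mderivC meval0.
  have [ek|//] := eqVneq (val e) (k + 2)%N.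
  by move: ek le (ltn_ord k) => /=; lia.
by rewrite mderivB mevalB !one.
Qed.

Lemma node_affine (m : nat) (A : comNzRingType) (y : 'rV[A]_(m - 3))
    (j : 'I_m) : (0 < j)%N ->
  node y j =
    affine_form (node (0 : 'rV[A]_(m - 3)) j) (fun k => dnode A k j) y.
Proof.
move=> j0; rewrite /affine_form /dnode.
have [j1|j1] := eqVneq (j : nat) 1%N.
  rewrite !node_first // big1 ?addr0 // => k _.
  by rewrite (_ : (_ == _)%N = false) ?mul0r //; lia.
have jm := ltn_ord j; case: (node_cases j0) => [/eqP|jl|[k jk]].
- by rewrite (negPf j1).
- rewrite !node_last ?big1 ?addr0 //; [|lia|lia] => k _.
  by rewrite (_ : (_ == _)%N = false) ?mul0r //; have := ltn_ord k; lia.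
- rewrite !(node_coord _ jk) mxE add0r (bigD1 k) //= jk eqxx mul1r.
  rewrite big1 ?addr0 //.
  move=> l lk; have [kl|_] := eqVneq (k + 2)%N (l + 2)%N; last by rewrite mul0r.
  by case/eqP: lk; apply: val_inj => /=; lia.
Qed.

Definition gap (m : nat) (A : comNzRingType) (x : 'rV[A]_(m - 3))
  (t : 'I_m * 'I_m) : A := node x t.2 - node x t.1.

Definition dgap (m : nat) (A : comNzRingType) (k : 'I_(m - 3))
  (t : 'I_m * 'I_m) : A := dnode A k t.2 - dnode A k t.1.

Definition is_pair (m : nat) (t : 'I_m * 'I_m) := index_pair t.1 t.2.

(** The likelihood equations over any field, so that real and complex solutions
are related by applying a field morphism. *)
Definition critical (F : fieldType) (m : nat) (w : 'I_m * 'I_m -> F)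
    (x : 'rV[F]_(m - 3)) : Prop :=
  (forall t, is_pair t -> gap x t != 0) /\
  (forall k, \sum_(t | is_pair t) w t / gap x t * dgap F k t = 0).

Lemma pair_gt0 (m : nat) (i j : 'I_m) :
  index_pair i j -> (0 < i)%N && (0 < j)%N.
Proof. by case/and3P => i0 ij _; rewrite i0 (ltn_trans i0 ij). Qed.

Lemma likelihood_solutionE (R : realType) (m : nat) (s : 'I_m -> 'I_m -> R)
    (x : 'rV[R[i]]_(m - 3)) :
  likelihood_solution s x <-> critical (fun t => real_complex R (s t.1 t.2)) x.
Proof.
have qE i j : index_pair i j -> meval (x 0) (q R[i] i j) = gap x (i, j).
  by move=> /pair_gt0/andP[i0 j0]; rewrite meval_q.
have dLE k : dL s k x =
    \sum_(t | is_pair t) real_complex R (s t.1 t.2) / gap x t * dgap R[i] k t.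
  rewrite /dL pair_big_dep; apply: eq_bigr => -[i j] /= ij.
  by rewrite qE // meval_mderiv_q //; case/pair_gt0/andP: ij.
split=> -[x0 dx0]; split.
- by case=> i j /= ij; rewrite -qE ?x0.
- by move=> k; rewrite -dLE dx0.
- by move=> i j ij; rewrite qE ?x0.
- by move=> k; rewrite dLE dx0.
Qed.

Lemma critical_map (F K : fieldType) (f : {rmorphism F -> K}) (m : nat)
    (w : 'I_m * 'I_m -> F) (x : 'rV[F]_(m - 3)) :
  critical (f \o w) (map_mx f x) <-> critical w x.
Proof.
have gapE t : gap (map_mx f x) t = f (gap x t).
  by rewrite /gap !node_map rmorphB.
have dgapE k t : dgap K k t = f (dgap F k t).
  by rewrite /dgap /dnode rmorphB !rmorph_nat.
have eqE k : \sum_(t | is_pair t) (f \o w) t / gap (map_mx f x) t * dgap K k t =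
    f (\sum_(t | is_pair t) w t / gap x t * dgap F k t).
  rewrite rmorph_sum; apply: eq_bigr => t _.
  by rewrite gapE dgapE !rmorphM fmorphV.
split=> -[x0 dx0]; split=> [t tP|k].
- by have := x0 t tP; rewrite gapE fmorph_eq0.
- by apply/eqP; rewrite -(fmorph_eq0 f) -eqE dx0.
- by rewrite gapE fmorph_eq0 x0.
- by rewrite eqE dx0 rmorph0.
Qed.

Lemma coord_column (m : nat) (k : 'I_(m - 3)) :
  exists e : 'I_m, e = (k + 2)%N :> nat.
Proof.
have kP : (k + 2 < m)%N by have := ltn_ord k; lia.
by exists (Ordinal kP).
Qed.

(** The position of the pair is recorded because the pair also singles out the
strictly positive term in [critical_halfplane]. *)
Lemma first_pair (m : nat) (k : 'I_(m - 3)) :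
  exists2 t : 'I_m * 'I_m, is_pair t &
   (forall (A : comNzRingType) (x : 'rV[A]_(m - 3)), gap x t = x 0 k) /\
   t.2 = (k + 2)%N :> nat /\ t.1 = 1%N :> nat.
Proof.
have [e ek] := coord_column k.
have m1 : (1 < m)%N by have := ltn_ord k; lia.
exists (Ordinal m1, e).
  by rewrite /is_pair /index_pair xpair_eqE /=; have := ltn_ord k; lia.
split=> // A x; rewrite /gap (node_coord _ ek) node_first ?subr0 //.
Qed.

Lemma last_pair (m : nat) (k : 'I_(m - 3)) :
  exists2 t : 'I_m * 'I_m, is_pair t &
   (forall (A : comNzRingType) (x : 'rV[A]_(m - 3)), gap x t = 1 - x 0 k).
Proof.
have [e ek] := coord_column k.
have m1 : (m.-1 < m)%N by have := ltn_ord k; lia.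
exists (e, Ordinal m1).
  by rewrite /is_pair /index_pair xpair_eqE /=; have := ltn_ord k; lia.
move=> A x; rewrite /gap (node_coord _ ek) node_last //.
by have := ltn_ord k; lia.
Qed.

Lemma coord_pair (m : nat) (k l : 'I_(m - 3)) : (k < l)%N ->
  exists2 t : 'I_m * 'I_m, is_pair t &
   (forall (A : comNzRingType) (x : 'rV[A]_(m - 3)), gap x t = x 0 l - x 0 k).
Proof.
move=> kl; have [e ek] := coord_column k; have [f fl] := coord_column l.
exists (e, f).
  by rewrite /is_pair /index_pair xpair_eqE /=; have := ltn_ord k; lia.
by move=> A x; rewrite /gap (node_coord _ ek) (node_coord _ fl).
Qed.

(** Each of the three cases quantifies over the ring, so that the same choice of
coordinates serves for two configurations at once. *)
Lemma gap_cases (m : nat) (t : 'I_m * 'I_m) : is_pair t ->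
  [\/ exists k, forall (A : comNzRingType) (x : 'rV[A]_(m - 3)),
          gap x t = x 0 k,
      exists k, forall (A : comNzRingType) (x : 'rV[A]_(m - 3)),
          gap x t = 1 - x 0 k |
      exists k l, k != l /\
        forall (A : comNzRingType) (x : 'rV[A]_(m - 3)),
          gap x t = x 0 l - x 0 k].
Proof.
case: t => i j; rewrite /is_pair /index_pair xpair_eqE /= => tP.
have i0 : (0 < i)%N by lia.
have j0 : (0 < j)%N by lia.
have jm := ltn_ord j.
case: (node_cases i0) => [i1|im|[k ik]]; last 2 first.
- by exfalso; lia.
- case: (node_cases j0) => [j1|jm'|[l jl]]; first by exfalso; lia.
  + constructor 2; exists k => B y; rewrite /gap (node_coord _ ik) node_last //.
    by have := ltn_ord k; lia.
  + constructor 3; exists k, l; split.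
      by apply: contraTneq tP => kl; rewrite ik jl kl; lia.
    by move=> B y; rewrite /gap (node_coord _ ik) (node_coord _ jl).
- case: (node_cases j0) => [j1|jm'|[l jl]]; try by exfalso; lia.
  constructor 1; exists l => B y.
  by rewrite /gap (node_coord _ jl) node_first ?subr0.
Qed.

(** * All solutions are real and lie between 0 and 1 *)

Section HalfPlane.
Variables (R : realType) (u v : R).

(** With eta = u - i v, these are Re (eta z) and Re (conj(eta) z); the inverse
1/z is a positive multiple of conj(z), so copairing of 1/z has the sign of
pairing of z. *)
Definition pairing (z : R[i]) : R := u * complex.Re z + v * complex.Im z.
Definition copairing (z : R[i]) : R := u * complex.Re z - v * complex.Im z.

Lemma copairingD z w : copairing (z + w) = copairing z + copairing w.
Proof. by case: z w => [a b] [a' b']; rewrite /copairing /=; ring. Qed.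

Lemma pairingB z w : pairing (z - w) = pairing z - pairing w.
Proof. by case: z w => [a b] [a' b']; rewrite /pairing /=; ring. Qed.

Lemma copairing_sum (I : finType) (P : pred I) (F : I -> R[i]) :
  copairing (\sum_(i | P i) F i) = \sum_(i | P i) copairing (F i).
Proof.
apply: (big_morph copairing copairingD).
by rewrite /copairing /= !mulr0 subrr.
Qed.

Lemma copairing_inv (c : R) (z : R[i]) :
  copairing (real_complex R c / z) =
  c * pairing z / (complex.Re z ^+ 2 + complex.Im z ^+ 2).
Proof. by case: z => a b; rewrite /copairing /pairing /=; ring. Qed.

Lemma sqr_mod_gt0 (z : R[i]) :
  z != 0 -> 0 < complex.Re z ^+ 2 + complex.Im z ^+ 2.
Proof.
case: z => a b; rewrite eq_complex /= => ab.
rewrite lt_def addr_ge0 ?sqr_ge0 // andbT paddr_eq0 ?sqr_ge0 //.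
by rewrite !sqrf_eq0.
Qed.

(** At a coordinate where the linear form is largest all summands of the
likelihood equation have nonnegative copairing, and the summand that comes from
the marked point 0 has positive copairing if the maximum exceeds both values 0
and u of the form at the fixed points. *)
Lemma critical_halfplane (m : nat) (s : 'I_m * 'I_m -> R)
    (x : 'rV[R[i]]_(m - 3)) :
  (forall t, is_pair t -> 0 < s t) ->
  critical (real_complex R \o s) x ->
  forall k, pairing (x 0 k) <= Num.max 0 u.
Proof.
move=> s0 [x0 dx0] k1; rewrite leNgt; apply/negP => bad.
have [k _ kmax] := @Order.TotalTheory.arg_maxP _ _ _ k1 xpredT
  (fun k => pairing (x 0 k)) isT.
have Mgt : Num.max 0 u < pairing (x 0 k) by apply: lt_le_trans bad (kmax _ isT).
have [M0 Mu] : 0 < pairing (x 0 k) /\ u < pairing (x 0 k).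
  by move: Mgt; rewrite gt_max => /andP[].
have nodeM (j : 'I_m) : (0 < j)%N -> pairing (node x j) <= pairing (x 0 k).
  move=> j0; case: (node_cases j0) => [j1|jm|[l jl]].
  - by rewrite node_first // /pairing /= !mulr0 addr0 ltW.
  - rewrite node_last //; last by have := ltn_ord k; lia.
    by rewrite /pairing /= mulr1 mulr0 addr0 ltW.
  - by rewrite (node_coord _ jl); exact: kmax.
have term_ge0 t : is_pair t ->
    0 <= copairing (real_complex R (s t) / gap x t * dgap R[i] k t).
  case: t => i j tP; have /andP[i0 j0] := pair_gt0 tP.
  have := x0 _ tP; have := s0 _ tP.
  rewrite /gap /dgap /dnode /= => st dt.
  have ij : (i < j)%N by case/and3P: tP.
  have [jk|jk] := eqVneq (j : nat) (k + 2)%N.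
    rewrite (_ : (i == _ :> nat) = false) ?subr0 ?mulr1; last by lia.
    rewrite copairing_inv divr_ge0 ?(ltW (sqr_mod_gt0 _)) //.
    by rewrite mulr_ge0 ?(ltW st) // pairingB (node_coord _ jk) subr_ge0 nodeM.
  have [ik|ik] := eqVneq (i : nat) (k + 2)%N; last first.
    by rewrite subrr mulr0 /copairing /= !mulr0 subrr.
  rewrite sub0r mulrN1 -mulrN -invrN copairing_inv divr_ge0 //.
    rewrite mulr_ge0 ?(ltW st) // opprB pairingB (node_coord _ ik).
    by rewrite subr_ge0 nodeM.
  by rewrite ltW // sqr_mod_gt0 // oppr_eq0.
have [t tP [gapt [t2 t1]]] := first_pair k.
have := congr1 copairing (dx0 k); rewrite copairing_sum (bigD1 t) //=.
have -> : copairing 0 = 0 by rewrite /copairing /= !mulr0 subrr.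
apply/eqP; rewrite gt_eqF // ltr_pwDl //; last first.
  by apply: sumr_ge0 => i /andP[iP _]; exact: term_ge0.
rewrite /dgap /dnode t2 t1 eqxx (_ : (1 == _)%N = false) ?subr0 ?mulr1;
  last by lia.
have := x0 _ tP; rewrite copairing_inv gapt => xk0.
by rewrite divr_gt0 ?sqr_mod_gt0 // mulr_gt0 ?s0.
Qed.

End HalfPlane.

Section Solutions.
Variables (R : realType) (m : nat) (s : 'I_m * 'I_m -> R).
Hypothesis s_gt0 : forall t, is_pair t -> 0 < s t.

Lemma critical_is_real (x : 'rV[R[i]]_(m - 3)) :
  critical (real_complex R \o s) x ->
  exists2 y : 'rV[R]_(m - 3), x = map_mx (real_complex R) y &
    forall k, 0 < y 0 k < 1.
Proof.
move=> crit; have half u v k := critical_halfplane u v s_gt0 crit k.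
have Im0 k : complex.Im (x 0 k) = 0.
  apply/eqP; rewrite eq_le; apply/andP; split.
    by have := half 0 1 k; rewrite /pairing mul0r add0r mul1r maxxx.
  have := half 0 (-1) k; rewrite /pairing mul0r add0r mulN1r maxxx.
  by rewrite oppr_le0.
exists (map_mx (@complex.Re R) x).
  by apply/rowP => k; rewrite !mxE; case: (x 0 k) (Im0 k) => a b /= ->.
move=> k; rewrite mxE.
have Re1 : complex.Re (x 0 k) <= 1.
  have := half 1 0 k; rewrite /pairing mul0r addr0 mul1r max_r //.
have Re0 : 0 <= complex.Re (x 0 k).
  have := half (-1) 0 k; rewrite /pairing mul0r addr0 mulN1r max_l ?oppr_le0 //.
have [t tP [gapt _]] := first_pair k; have := crit.1 t tP; rewrite gapt => x0.
have [t' t'P gapt'] := last_pair k; have := crit.1 t' t'P; rewrite gapt' => x1.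
move: x0 x1 Re0 Re1 (Im0 k); case: (x 0 k) => a b /= x0 x1 a0 a1 b0.
rewrite !lt_neqAle a0 a1 !andbT; apply/andP; split.
  by apply: contraNneq x0 => <-; rewrite b0.
by apply: contraNneq x1 => ->; rewrite b0 subrr.
Qed.

(** * One solution for each ordering *)

Definition chamber (p : 'S_(m - 3)) (y : 'rV[R]_(m - 3)) : Prop :=
  (forall k, 0 < y 0 k < 1) /\
  (forall a b : 'I_(m - 3), (a < b)%N -> y 0 (p a) < y 0 (p b)).

(** A reference point of the chamber: the equally spaced points of ]0, 1[ in the
order p. *)
Definition center (p : 'S_(m - 3)) : 'rV[R]_(m - 3) :=
  \row_k ((p^-1%g k).+1%:R / (m - 3).+1%:R).

Lemma center_chamber p : chamber p (center p).
Proof.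
have m0 : 0 < (m - 3).+1%:R :> R by rewrite ltr0n.
split=> [k|a b ab]; rewrite !mxE.
  by rewrite divr_gt0 ?ltr0n //= ltr_pdivrMr // mul1r ltr_nat ltnS ltn_ord.
by rewrite ltr_pM2r ?invr_gt0 // !permK ltr_nat ltnS.
Qed.

Lemma chamber_lt p y (a b : 'I_(m - 3)) : chamber p y ->
  (y 0 a < y 0 b) = (p^-1%g a < p^-1%g b)%N.
Proof.
move=> [_ ysort]; rewrite -[in LHS](permKV p a) -[in LHS](permKV p b).
move: (p^-1%g a) (p^-1%g b) => {}a {}b.
case: (ltngtP a b) => [/ysort //|/ysort yba|/val_inj ->]; last by rewrite ltxx.
by rewrite lt_gtF.
Qed.

Definition orientation (p : 'S_(m - 3)) (t : 'I_m * 'I_m) : R :=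
  Num.sg (gap (center p) t).

(** The chamber of p is the region of the hyperplane arrangement that contains
its center: the bounds 0 and 1 and the comparisons of two coordinates are
exactly the signs of the q_ij. *)
Lemma chamber_gap p y : chamber p y <->
  (forall t, is_pair t -> 0 < orientation p t * gap y t).
Proof.
have cC := center_chamber p; split=> [yC t tP|pos].
  case: (gap_cases tP) => [[k gapt]|[k gapt]|[k [l [kl gapt]]]].
  - rewrite /orientation !gapt; have /andP[c0 _] := cC.1 k.
    by rewrite gtr0_sg // mul1r; have /andP[] := yC.1 k.
  - rewrite /orientation !gapt; have /andP[_ c1] := cC.1 k.
    by rewrite gtr0_sg ?subr_gt0 // mul1r subr_gt0; have /andP[] := yC.1 k.
  - rewrite /orientation !gapt.
    have := chamber_lt k l yC; have := chamber_lt l k yC.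
    rewrite -!(chamber_lt _ _ cC).
    have [lt|lt|eq] := ltgtP (center p 0 k) (center p 0 l) => yl yk.
    + by rewrite gtr0_sg ?subr_gt0 // mul1r subr_gt0 yk.
    + by rewrite ltr0_sg ?subr_lt0 // mulN1r opprB subr_gt0 yl.
    + have := chamber_lt k l cC; have := chamber_lt l k cC; rewrite eq ltxx.
      move=> h1 h2; suff /perm_inj kl' : p^-1%g k = p^-1%g l.
        by rewrite kl' eqxx in kl.
      by apply: val_inj => /=; lia.
split=> [k|a b ab].
  have /andP[c0 c1] := cC.1 k.
  have [t tP [gapt _]] := first_pair k; have [t' t'P gapt'] := last_pair k.
  have := pos t tP; have := pos t' t'P; rewrite /orientation !gapt !gapt'.
  by rewrite !gtr0_sg ?subr_gt0 // !mul1r subr_gt0 => -> ->.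
have cab := cC.2 a b ab.
case: (ltngtP (p a) (p b)) => [lt|lt|/val_inj/perm_inj eq].
- have [t tP gapt] := coord_pair lt; have := pos t tP.
  rewrite /orientation !gapt.
  by rewrite gtr0_sg ?subr_gt0 // mul1r subr_gt0.
- have [t tP gapt] := coord_pair lt; have := pos t tP.
  rewrite /orientation !gapt.
  by rewrite ltr0_sg ?subr_lt0 // mulN1r opprB subr_gt0.
- by rewrite eq ltnn in ab.
Qed.

(** Spelled out as an affine form, to which the general results on weighted sums
of logarithms apply. *)
Definition oriented_gap (p : 'S_(m - 3)) (t : 'I_m * 'I_m) :=
  affine_form (orientation p t * gap (0 : 'rV[R]_(m - 3)) t)
    (fun k => orientation p t * dgap R k t).

Lemma oriented_gapE p t y : is_pair t ->
  oriented_gap p t y = orientation p t * gap y t.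
Proof.
case: t => i j tP; have /andP[i0 j0] := pair_gt0 tP.
rewrite /oriented_gap /gap /dgap /= !(node_affine y) // /affine_form /=.
rewrite opprD addrACA [in RHS]mulrDr -sumrB mulr_sumr; congr (_ + _).
by apply: eq_bigr => k _; ring.
Qed.

Lemma orientation_neq0 p t : is_pair t -> orientation p t != 0.
Proof.
move=> tP; have /chamber_gap/(_ t tP) := center_chamber p.
by apply: contraTneq => ->; rewrite mul0r ltxx.
Qed.

Lemma chamber_oriented p y : chamber p y <->
  (forall t, is_pair t -> 0 < oriented_gap p t y).
Proof.
rewrite chamber_gap.
by split=> pos t tP; have := pos t tP; rewrite oriented_gapE.
Qed.

(** Changing the sign of a form leaves its logarithmic derivative unchanged. *)
Lemma critical_oriented p y : chamber p y -> critical s y <->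
  (forall k, \sum_(t | is_pair t)
    s t / oriented_gap p t y * (orientation p t * dgap R k t) = 0).
Proof.
move=> /chamber_gap pos.
have gap0 t : is_pair t -> gap y t != 0.
  by move=> tP; apply: contraTneq (pos t tP) => ->; rewrite mulr0 ltxx.
have sumE k : \sum_(t | is_pair t)
    s t / oriented_gap p t y * (orientation p t * dgap R k t) =
    \sum_(t | is_pair t) s t / gap y t * dgap R k t.
  apply: eq_bigr => t tP; rewrite oriented_gapE //.
  by field; rewrite gap0 // orientation_neq0.
split=> [[_ crit] k|crit]; first by rewrite sumE.
by split=> // k; rewrite -sumE.
Qed.

Lemma exists_critical_chamber p : exists2 y, chamber p y & critical s y.
Proof.
have [||y yP crit] := @exists_critical_point R (m - 3) _ (@is_pair m) s
  (fun t => orientation p t * gap (0 : 'rV[R]_(m - 3)) t)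
  (fun t k => orientation p t * dgap R k t) 0 1 (center p) s_gt0.
- move=> x /chamber_oriented [x01 _] k.
  by have /andP[] := x01 k => ? ?; rewrite !ltW.
- exact/chamber_oriented/center_chamber.
have yC : chamber p y by exact/chamber_oriented.
by exists y => //; apply/(critical_oriented yC).
Qed.

Lemma critical_chamber_unique p y z :
  chamber p y -> chamber p z -> critical s y -> critical s z -> y = z.
Proof.
move=> yC zC yc zc.
have eq_form := critical_point_unique s_gt0 ((chamber_oriented p y).1 yC)
  ((chamber_oriented p z).1 zC) ((critical_oriented yC).1 yc)
  ((critical_oriented zC).1 zc).
apply/rowP => k; have [t tP [gapt _]] := first_pair k.
have := eq_form t tP; rewrite -!/(oriented_gap _ _ _) !oriented_gapE // !gapt.
exact/mulfI/orientation_neq0.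
Qed.

Lemma critical_inj (y : 'rV[R]_(m - 3)) : critical s y -> injective (y 0).
Proof.
move=> [gap0 _].
have lt_neq (k l : 'I_(m - 3)) : (k < l)%N -> y 0 k != y 0 l.
  move=> /coord_pair[t tP gapt]; have := gap0 t tP.
  by rewrite gapt subr_eq0 eq_sym.
move=> k l ykl; apply: val_inj; case: (ltngtP k l) => // /lt_neq.
  by rewrite ykl eqxx.
by rewrite ykl eqxx.
Qed.

(** In a chamber the permutation is recovered from the ranking of the
coordinates. *)
Lemma chamber_inj p p' y : chamber p y -> chamber p' y -> p = p'.
Proof.
move=> yC yC'.
have rankE (r : 'S_(m - 3)) k : chamber r y ->
    #|[set l | y 0 l < y 0 k]%SET| = (r^-1%g k) :> nat.
  move=> rC; rewrite -(card_imset _ (@perm_inj _ r^-1%g)).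
  have -> : [set r^-1%g x | x in [set l | y 0 l < y 0 k]]%SET =
      [set l : 'I_(m - 3) | l < r^-1%g k]%N%SET.
    apply/setP => l; rewrite inE; apply/imsetP/idP.
      by case=> i; rewrite inE (chamber_lt _ _ rC) => ik ->.
    move=> lk; exists (r l); last by rewrite permK.
    by rewrite inE (chamber_lt _ _ rC) permK.
  rewrite -sum1dep_card -(big_ord_widen _ (fun=> 1%N) (ltnW (ltn_ord _))).
  by rewrite sum1_card card_ord.
apply: invg_inj; apply/permP => k; apply: val_inj.
by rewrite /= -(rankE _ _ yC) -(rankE _ _ yC').
Qed.

End Solutions.

(** * Counting the solutions *)

(** The number of smaller coordinates is the position of a coordinate in the
sorted order; the inverse of this ranking sorts. *)
Lemma exists_sorting_perm (R : realDomainType) n (y : 'rV[R]_n) :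
  injective (y 0) ->
  exists p : 'S_n, forall a b : 'I_n, (a < b)%N -> y 0 (p a) < y 0 (p b).
Proof.
move=> y_inj; pose below k := [set l | y 0 l < y 0 k]%SET.
have belowS k l : y 0 k < y 0 l -> (#|below k| < #|below l|)%N.
  move=> kl; apply: proper_card; apply/properP; split.
    by apply/fintype.subsetP => i; rewrite !inE => /lt_trans; exact.
  by exists k; rewrite !inE ?ltxx.
have rankP k : (#|below k| < n)%N.
  rewrite -[X in (_ < X)%N]card_ord -cardsT; apply: proper_card.
  by apply/properP; split; [exact: finset.subsetT|exists k; rewrite !inE ?ltxx].
pose rank k := Ordinal (rankP k).
have rank_inj : injective rank.
  move=> k l [kl]; apply: y_inj; apply/eqP; rewrite eq_le !leNgt.
  by apply/andP; split; apply/negP => /belowS; rewrite kl ltnn.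
exists (perm rank_inj)^-1%g => a b ab.
rewrite ltNge le_eqVlt; apply/negP => /orP[/eqP/y_inj/perm_inj ba|/belowS].
  by rewrite ba ltnn in ab.
have rankK c : #|below ((perm rank_inj)^-1%g c)| = c.
  by have := permKV (perm rank_inj) c; rewrite permE => /(congr1 val).
by rewrite !rankK ltnNge ltnW.
Qed.

Lemma card_setT_fintype (T : finType) : [set: T] #= `I_#|T|.
Proof.
rewrite (card_eqr card_II).
have -> : [set: T] = enum_val @` [set: 'I_#|T|].
  by apply/seteqP; split=> // p _; exists (enum_rank p); rewrite ?enum_rankK.
by apply: inj_card_eq => i j _ _; exact: enum_val_inj.
Qed.

Theorem proposition1 (R : realType) (m : nat) (s : 'I_m -> 'I_m -> R)
    (hm : (4 <= m)%N)
    (hs : forall i j : 'I_m, index_pair i j -> 0 < s i j) :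
  [/\ [set x : 'rV[R[i]]_(m - 3) | likelihood_solution s x]
        #= `I_((m - 3)`!),
      forall x : 'rV[R[i]]_(m - 3), likelihood_solution s x ->
        forall k : 'I_(m - 3), x 0 k \is Num.real
    & forall p : 'S_(m - 3), exists! y : 'rV[R]_(m - 3),
        likelihood_solution s (map_mx (real_complex R) y) /\
        forall a b : 'I_(m - 3), (a < b)%N -> y 0 (p a) < y 0 (p b)].
Proof.
pose w (t : 'I_m * 'I_m) := s t.1 t.2.
have w_gt0 t : is_pair t -> 0 < w t by exact: hs.
have solE (y : 'rV[R]_(m - 3)) :
    likelihood_solution s (map_mx (real_complex R) y) <-> critical w y.
  by rewrite likelihood_solutionE; exact: critical_map.
have sol_real x : likelihood_solution s x ->
    exists2 y : 'rV[R]_(m - 3), x = map_mx (real_complex R) y &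
      forall k, 0 < y 0 k < 1.
  by rewrite likelihood_solutionE; exact: critical_is_real.
have sol01 (y : 'rV[R]_(m - 3)) : critical w y -> forall k, 0 < y 0 k < 1.
  by move=> /solE/sol_real[z /map_mx_inj ->].
have /boolp.choice[f fP] p :
    exists y : 'rV[R]_(m - 3), chamber p y /\ critical w y.
  by have [y yC yc] := exists_critical_chamber w_gt0 p; exists y.
split.
- have -> : [set x | likelihood_solution s x] =
      (map_mx (real_complex R) \o f) @` [set: 'S_(m - 3)].
    apply/seteqP; split=> [x xsol|_ [p _ <-]] /=; last first.
      by apply/solE; case: (fP p).
    have [y xE y01] := sol_real x xsol; have yc : critical w y.
      by apply/solE; rewrite -xE.
    have [p psort] := exists_sorting_perm (critical_inj yc).
    exists p => //=; rewrite xE; congr map_mx.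
    have [fC fc] := fP p.
    exact: (critical_chamber_unique w_gt0 fC (conj y01 psort)).
  apply: card_eq_trans (_ : [set: 'S_(m - 3)] #= _).
    apply: inj_card_eq => p p' _ _ /= /map_mx_inj ff.
    apply: (@chamber_inj R m p p' (f p)); first by case: (fP p).
    by rewrite ff; case: (fP p').
  by rewrite -card_Sn; exact: card_setT_fintype.
- move=> x /sol_real[y -> _] k; rewrite mxE.
  by apply/complex_realP; exists (y 0 k).
- move=> p; have [fC fc] := fP p; exists (f p); split.
    by split; [exact/solE|exact: fC.2].
  move=> y [/solE yc ysort].
  exact: (critical_chamber_unique w_gt0 fC (conj (sol01 y yc) ysort)).
Qed.
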